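(* Let $f:\mathbb{R}^n\to\mathbb{R}$ be convex and differentiable with $L$-Lipschitz gradient ($L>0$), let $g:\mathbb{R}^n\to\mathbb{R}\cup\{+\infty\}$ be convex, proper and lower semi-continuous, let $F=f+g$, and assume that $X^\star=\operatorname{argmin}F$ is nonempty and closed, with $F^\star=F(x^\star)>-\infty$ for any $x^\star\in X^\star$. Take $\gamma>0$ and $\alpha_k\ge 0$. Then, for an iteration, with $k>0$ even, of the proximal gradient algorithm with alternated inertia, that is $$y_{k+1}=\mathsf{T}_\gamma(x_k),\qquad x_{k+1}=y_{k+1}+\alpha_k(y_{k+1}-y_k),\qquad y_{k+2}=\mathsf{T}_\gamma(x_{k+1}),\qquad x_{k+2}=y_{k+2}\qquad(k\text{ even}),$$ one has $$F(y_{k+2})\le F(y_k)-\frac{2-\alpha_k-\gamma L}{2\gamma}\left[\|y_{k+2}-x_{k+1}\|^2+\|y_{k+1}-x_k\|^2\right]$$ $$\le F(y_k)-\frac{(2-\alpha_k-\gamma L)\gamma}{2(1+\gamma L)^2}\,\operatorname{dist}(0,\partial F(y_{k+2}))^2 .$$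
   Context: $\|\cdot\|$ is the Euclidean norm on $\mathbb{R}^n$. The proximal operator of a function $h$ is $\mathbf{prox}_h(x)=\operatorname{argmin}_{w\in\mathbb{R}^n}\left(h(w)+\frac12\|w-x\|^2\right)$, and the proximal gradient operator is $\mathsf{T}_\gamma(x)=\mathbf{prox}_{\gamma g}(x-\gamma\nabla f(x))$. $\partial F$ is the convex subdifferential of $F$ and $\operatorname{dist}(0,S)=\inf_{s\in S}\|s\|$. The four updates displayed in the claim are performed for each even $k$, so that $x_k=y_k$ for every even $k>0$.
   Formalization: The second inequality is stated only under the added condition 2 − α_k − γL ≥ 0; without it it fails, e.g. for n=1, f(x)=x²/2, g=0, L=1, γ=10, α_k=0, x_0=y_0=1, k=2. The first inequality is stated without this condition. *)

(* Defs.v *)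
From HB Require Import structures.
From mathcomp Require Import all_boot all_order all_algebra.
From mathcomp Require Import all_classical all_reals all_analysis.

Set Implicit Arguments.
Unset Strict Implicit.
Unset Printing Implicit Defensive.

Import Order.TTheory GRing.Theory Num.Theory.
Import numFieldNormedType.Exports.

Local Open Scope classical_set_scope.
Local Open Scope ring_scope.

Section ProximalGradient.
Context {R : realType} {n : nat}.
Local Notation V := 'rV[R]_n.
Implicit Types (x y u v w z s : V) (f : V -> R) (g h F : V -> \bar R).

Definition dotp u v : R := \sum_(i < n) u 0 i * v 0 i.

(* The library norm `|u| on row vectors is the sup norm, hence this definition;
   both norms induce the library topology on 'rV[R]_n. *)
Definition norm2 u : R := Num.sqrt (dotp u u).

(* Vector of partial derivatives; it represents the differential 'd f x when f
   is differentiable at x. *)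
Definition grad f x : V := \row_(i < n) 'D_(delta_mx 0 i) f x.

Definition lipschitz_grad (L : R) f :=
  forall x y, norm2 (grad f x - grad f y) <= L * norm2 (x - y).

(* The library's convex_function only covers real-valued functions. At t = 0 or
   t = 1 the convention 0 * +oo = 0 makes the inequality trivial. *)
Definition econvex g :=
  forall x y (t : R), 0 <= t <= 1 ->
    (g (t *: x + (1 - t) *: y)%R <= t%:E * g x + (1 - t)%:E * g y)%E.

Definition eproper g :=
  (forall x, -oo < g x)%E /\ (exists x, g x < +oo)%E.

Definition objective f g : V -> \bar R := fun x => ((f x)%:E + g x)%E.

Definition argmin h : set V := [set x | forall z, (h x <= h z)%E].

(* xget chooses a minimizer; the value is 0 only when there is none, which does
   not happen for a proper convex lower semicontinuous h. *)
Definition prox h x : V :=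
  xget 0 (argmin (fun w => h w + (2^-1 * norm2 (w - x) ^+ 2)%:E)%E).

Definition prox_grad (gamma : R) f g x : V :=
  prox (fun w => gamma%:E * g w)%E (x - gamma *: grad f x).

Definition subdiff F x : set V :=
  [set s | forall z, (F x + (dotp s (z - x))%:E <= F z)%E].

(* In \bar R, so that the distance to the empty set is +oo. *)
Definition dist0 (S : set V) : \bar R := ereal_inf [set (norm2 s)%:E | s in S].

Definition alternated_inertia (T : V -> V) (alpha : nat -> R)
    (x y : nat -> V) :=
  forall k, ~~ odd k ->
    [/\ y k.+1 = T (x k),
        x k.+1 = y k.+1 + alpha k *: (y k.+1 - y k),
        y k.+2 = T (x k.+1)
      & x k.+2 = y k.+2].

End ProximalGradient.

(* Main.v *)
Require Import Defs.
From HB Require Import structures.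
From mathcomp Require Import all_boot all_order all_algebra.
From mathcomp Require Import all_classical all_reals all_analysis.
From mathcomp Require Import ring lra.

(** One application of the proximal gradient operator at [x], with output [p],
    comes with the subgradient [(x - p) / gamma - grad f x] of [g] at [p]
    ([prox_grad_subgradient]).  Adding the subgradient inequality of [g] at
    [p], the gradient inequality of [f] at [x] and the descent lemma for [f]
    between [x] and [p] gives, for every [z] ([prox_grad_step]),
    [F p + <x - p, z - p> / gamma - L / 2 * |p - x|^2 <= F z].
    Since [k] is even and positive, [x k = y k].  The step from [x k] compared
    with [z = y k], and the step from [x k.+1] compared with [z = y k.+1],
    add up to a lower bound on [F (y k) - F (y k.+2)]; with
    [d = y k.+2 - x k.+1] and [e = y k.+1 - x k], it exceeds the claimed
    decrease by exactly [alpha k / (2 gamma) * |d + e|^2] ([inertia_gain]).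

    For the second inequality, moving the gradient of [f] from [x k.+1] to
    [y k.+2] turns the subgradient of [g] into one of [F] at [y k.+2]
    ([prox_grad_subdiff]), of norm at most [(1 + gamma L) / gamma * |d|] by
    Lipschitz continuity; the term [|e|^2] is dropped.

    What remains is that the proximal operator really returns a minimizer.
    At a minimizer of [F], the smooth part [f] can be replaced by its
    linearization, so [- grad f] is there a subgradient of [g]
    ([argmin_subdiff]); this affine minorant makes [g] plus a quadratic
    coercive, and lower semicontinuity on a compact box yields the minimizer
    ([argmin_quad_neq0]).  The same linearization, applied to the quadratic
    that defines the proximal operator, gives the subgradient used above. *)

Import Order.TTheory GRing.Theory Num.Theory.
Import numFieldNormedType.Exports.

Local Open Scope classical_set_scope.
Local Open Scope ring_scope.

(** * Lower semicontinuity and limits *)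

(** The sublevel sets [h <= h z] of the points [z] of [K] generate a filter on
    [K]; lower semicontinuity puts any of its cluster points in each of them,
    so such a point is a minimizer. *)
Lemma lsc_attains_min (R : realType) (T : topologicalType) (h : T -> \bar R)
    (K : set T) :
  lower_semicontinuous h -> compact K -> K !=set0 ->
  exists2 p, K p & forall z, K z -> (h p <= h z)%E.
Proof.
move=> hl Kc [k0 Kk0].
pose B z := [set w | K w /\ (h w <= h z)%E].
have FF : ProperFilter (filter_from K B).
  apply: filter_from_proper; last by move=> z Kz; exists z.
  apply: filter_from_filter; first by exists k0.
  move=> z z' Kz Kz'; case: (leP (h z) (h z')) => zz'.
    by exists z => // w [Kw wz]; do 2 split => //; exact: le_trans zz'.
  by exists z' => // w [Kw wz]; do 2 split => //; apply: le_trans wz (ltW _).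
have FK : filter_from K B K by exists k0 => // w [].
have [p [Kp clp]] := Kc _ FF FK.
exists p => // z Kz; rewrite leNgt; apply/negP => hzp.
have [a za ap] : exists2 a : R, (h z < a%:E)%E & (a%:E < h p)%E.
  case: (h z) (h p) hzp => [r| |] [r'| |]//=; rewrite ?lte_fin => rr'.
  - by exists ((r + r') / 2); rewrite lte_fin midf_lt.
  - by exists (r + 1); rewrite ?ltry// lte_fin ltrDl.
  - by exists (r' - 1); rewrite ?ltNyr// lte_fin ltrBlDr ltrDl.
  - by exists 0; rewrite ?ltry ?ltNyr.
have [V pV Va] := hl _ _ ap.
have FB : filter_from K B (B z) by exists z.
have [w [[_ wz] /Va aw]] := clp _ _ FB pV.
by have := lt_trans aw (le_lt_trans wz za); rewrite ltxx.
Qed.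

(** Letting [t] tend to 0. *)
Lemma le_of_le_scale (R : realType) (a b c : R) :
  (forall t, 0 < t <= 1 -> a <= b + t * c) -> a <= b.
Proof.
move=> H; apply/ler_addgt0Pr => e e0.
have c0 : 0 < `|c| + 1 by rewrite ltr_wpDl.
pose t := Num.min 1 (e / (`|c| + 1)).
have t0 : 0 < t by rewrite lt_min ltr01 divr_gt0.
have := H t; rewrite t0 ge_min lexx => /(_ isT) /le_trans; apply.
rewrite lerD2l; apply: (@le_trans _ _ (t * (`|c| + 1))).
  by rewrite ler_pM2l//; apply: le_trans (ler_norm c) _; rewrite lerDl.
by rewrite -ler_pdivlMr// ge_min lexx orbT.
Qed.

Section ProximalGradientStep.
Context {R : realType} {n : nat}.
Implicit Types u v w x z p s d e : 'rV[R]_n.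

(** * Euclidean inner product *)

Lemma dotpC u v : dotp u v = dotp v u.
Proof. by apply: eq_bigr => i _; rewrite mulrC. Qed.

Lemma dotpDl u v w : dotp (u + v) w = dotp u w + dotp v w.
Proof. by rewrite -big_split; apply: eq_bigr => i _; rewrite mxE mulrDl. Qed.

Lemma dotpZl a u v : dotp (a *: u) v = a * dotp u v.
Proof. by rewrite mulr_sumr; apply: eq_bigr => i _; rewrite mxE mulrA. Qed.

Lemma dotpNl u v : dotp (- u) v = - dotp u v.
Proof. by rewrite -scaleN1r dotpZl mulN1r. Qed.

Lemma dotpDr u v w : dotp u (v + w) = dotp u v + dotp u w.
Proof. by rewrite dotpC dotpDl !(dotpC u). Qed.

Lemma dotpZr a u v : dotp u (a *: v) = a * dotp u v.
Proof. by rewrite dotpC dotpZl dotpC. Qed.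

Lemma dotpNr u v : dotp u (- v) = - dotp u v.
Proof. by rewrite dotpC dotpNl dotpC. Qed.

Definition dotpE := (dotpDl, dotpDr, dotpNl, dotpNr, dotpZl, dotpZr).

Lemma dotp_ge0 u : 0 <= dotp u u.
Proof. by apply: sumr_ge0 => i _; rewrite -expr2 sqr_ge0. Qed.

Lemma norm2_ge0 u : 0 <= norm2 u.
Proof. exact: sqrtr_ge0. Qed.

Lemma norm2_sqr u : norm2 u ^+ 2 = dotp u u.
Proof. by rewrite sqr_sqrtr ?dotp_ge0. Qed.

Lemma norm2Z a u : 0 <= a -> norm2 (a *: u) = a * norm2 u.
Proof.
move=> a0; rewrite /norm2 dotpZl dotpZr mulrA sqrtrM ?mulr_ge0//.
by rewrite -expr2 sqrtr_sqr ger0_norm.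
Qed.

Lemma norm2N u : norm2 (- u) = norm2 u.
Proof. by rewrite /norm2 dotpNl dotpNr opprK. Qed.

Lemma coord_le_norm2 u i : `|u 0 i| <= norm2 u.
Proof.
rewrite -sqrtr_sqr /norm2 ler_wsqrtr// /dotp (bigD1 i)//= -expr2 lerDl.
by apply: sumr_ge0 => j _; rewrite -expr2 sqr_ge0.
Qed.

(** At a pair of vectors with norms [a] and [b], this is the nonnegativity of
    [|b u - a v|^2 = 2 a b (a b - <u, v>)] when [a b > 0]; otherwise one of
    the vectors is zero. *)
Lemma cauchy_schwarz u v : dotp u v <= norm2 u * norm2 v.
Proof.
have nul w z : norm2 w = 0 -> dotp w z = 0.
  move=> w0; apply: big1 => i _; have := coord_le_norm2 w i.
  by rewrite w0 normr_le0 => /eqP ->; rewrite mul0r.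
set a := norm2 u; set b := norm2 v.
have a0 : 0 <= a := norm2_ge0 u.
have b0 : 0 <= b := norm2_ge0 v.
have := dotp_ge0 (b *: u - a *: v).
rewrite !dotpE (dotpC v u) -!norm2_sqr -/a -/b => ab.
have {}ab : 0 <= (a * b) * (a * b - dotp u v) by nra.
have [ab0|ab0] := ltP 0 (a * b).
  by move: ab; rewrite pmulr_rge0// subr_ge0.
have {ab0} /eqP : a * b = 0 by apply/eqP; rewrite eq_le ab0 mulr_ge0.
rewrite mulf_eq0 => /orP[] /eqP e; first by rewrite nul ?mulr_ge0.
by rewrite dotpC nul ?mulr_ge0.
Qed.

Lemma norm2D u v : norm2 (u + v) <= norm2 u + norm2 v.
Proof.
rewrite -ler_sqr ?nnegrE ?addr_ge0 ?norm2_ge0// norm2_sqr.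
rewrite !dotpE (dotpC v u) -!norm2_sqr; have := cauchy_schwarz u v; nra.
Qed.

Lemma continuous_norm2_sqr x : continuous (fun w => norm2 (w - x) ^+ 2).
Proof.
under eq_fun => w do rewrite norm2_sqr.
have cc i : continuous (fun w => (w - x) 0 i).
  have -> : (fun w : 'rV[R]_n => (w - x) 0 i) = (fun w => w 0 i - x 0 i).
    by apply/funext => w; rewrite !mxE.
  move=> w.
  apply: (@cvgB R R^o _ (nbhs w) _ (fun v : 'rV[R]_n => v 0 i) (fun=> x 0 i)).
    exact: (@coord_continuous R 1 n 0 i w).
  exact: cvg_cst.
rewrite /dotp; apply: continuous_big => [|i _ w]; first exact: add_continuous.
by apply: (@cvgM R _ (nbhs w)); exact: cc.
Qed.

(** * Convex and smooth functions *)

Lemma lsc_objective (phi : 'rV[R]_n -> R) (g : 'rV[R]_n -> \bar R) :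
  continuous phi -> lower_semicontinuous g ->
  lower_semicontinuous (objective phi g).
Proof.
move=> phic gl x a; rewrite /objective -lteBlDl// => agx.
have [b ab bgx] : exists2 b : R, a - phi x < b & (b%:E < g x)%E.
  move: agx; case: (g x) => [r| |]//=.
  - rewrite -EFinB lte_fin => ar.
    exists ((a - phi x + r) / 2); first by rewrite midf_lt.
    by rewrite lte_fin midf_lt.
  - by move=> _; exists (a - phi x + 1); rewrite ?ltry// ltrDl.
have [V xV Vb] := gl _ _ bgx.
exists (V `&` [set w | a - b < phi w]).
  apply: filterI => //.
  by apply: (cvgr_gt (phi x) (phic x)); lra.
move=> w [/Vb bg /= abphi].
rewrite -lteBlDl//; apply: le_lt_trans bg.
by rewrite -EFinB lee_fin; lra.
Qed.

Lemma dotp_grad (f : 'rV[R]_n -> R) x d :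
  differentiable f x -> dotp (grad f x) d = 'D_d f x.
Proof.
move=> fx; rewrite deriveE// {2}(row_sum_delta d) linear_sum.
by apply: eq_bigr => i _; rewrite linearZ mxE deriveE// mulrC.
Qed.

Lemma is_derive_line (f : 'rV[R]_n -> R) x d (t : R) :
  differentiable f (x + t *: d) ->
  is_derive t 1 (fun r => f (x + r *: d)) (dotp (grad f (x + t *: d)) d).
Proof.
move=> fx; rewrite dotp_grad//.
(* Both difference quotients are the same function of the increment. *)
have E : (fun h => h^-1 *: (((fun r => f (x + r *: d)) \o shift t) (h *: 1) -
    f (x + t *: d))) =
  (fun h => h^-1 *: ((f \o shift (x + t *: d)) (h *: d) - f (x + t *: d))).
  apply/funext => h /=; congr (_ *: (f _ - _)).
  by rewrite -[h *: 1]/(h * 1) mulr1 scalerDl addrCA.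
have fd : derivable f (x + t *: d) d by exact: diff_derivable.
by apply: DeriveDef; rewrite /derivable /derive E.
Qed.

(** The function [psi] below, up to a constant the gap between [f] and its
    quadratic bound along the segment, has a nonpositive derivative. *)
Lemma descent (f : 'rV[R]_n -> R) (L : R) x y :
  (forall z, differentiable f z) -> lipschitz_grad L f ->
  f y <= f x + dotp (grad f x) (y - x) + L / 2 * norm2 (y - x) ^+ 2.
Proof.
move=> fd fl; set d := y - x.
pose A := dotp (grad f x) d; pose B := L / 2 * norm2 d ^+ 2.
pose psi (t : R) := f (x + t *: d) - (t * A + t ^+ 2 * B).
pose dpsi (t : R) := dotp (grad f (x + t *: d)) d - (A + 2 * t * B).
have dpsiP (t : R) : is_derive t 1 psi (dpsi t).
  have h1 := is_derive_line _ _ d _ (fd (x + t *: d)).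
  have h2 : is_derive t 1 (fun t : R => t * A + t ^+ 2 * B) (A + 2 * t * B).
    have -> : (fun t : R => t * A + t ^+ 2 * B) =
        A *: @id R + B *: (@id R * @id R).
      by apply/funext => r; rewrite /= expr2 mulrC (mulrC _ B).
    apply: is_derive_eq; rewrite /GRing.scale/=; ring.
  exact: is_deriveB.
have [|c c01] := @MVT R psi dpsi 0 1 ltr01 (fun t _ => dpsiP t).
  by apply: derivable_within_continuous => t _; have [] := dpsiP t.
have c0 : 0 <= c by move: c01; rewrite in_itv/= => /andP[/ltW].
have dc : dpsi c <= 0.
  have -> : dpsi c =
      dotp (grad f (x + c *: d) - grad f x) d - c * (L * norm2 d ^+ 2).
    by rewrite /dpsi /A /B !dotpE; field.
  rewrite subr_le0; apply: le_trans (cauchy_schwarz _ _) _.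
  have := fl (x + c *: d) x; rewrite (addrC x) addrK (norm2Z _ _ c0) => le_c.
  have := ler_wpM2r (norm2_ge0 d) le_c; nra.
have e1 : x + 1 *: d = y by rewrite scale1r addrC subrK.
rewrite /psi e1 scale0r addr0 -/A => psi01; rewrite -/B; nra.
Qed.

(** By convexity the difference quotients of [f] at [x] along [y - x] with
    positive step at most 1 are at most [f y - f x]; so is their limit at 0. *)
Lemma gradient_ineq (f : 'rV[R]_n -> R) x y :
  convex_function (setT : set (convex_lmodType 'rV[R]_n)) f ->
  differentiable f x -> f x + dotp (grad f x) (y - x) <= f y.
Proof.
move=> fc fd; rewrite -lerBrDl dotp_grad//.
have : derivable f x (y - x) by exact: diff_derivable.
move=> /(@cvg_dnbhs_at_right R R^o).
move=> /(@cvgr_to_le R _ _ R); apply.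
near=> h.
have h0 : 0 < h by [].
have h1 : h <= 1 by near: h; apply: nbhs_right_le.
have inT (w : convex_lmodType 'rV[R]_n) : w \in setT by rewrite in_setT.
have le_conv : f (h *: y + (1 - h) *: x) <= h * f y + (1 - h) * f x :=
  fc (Itv01 (ltW h0) h1) y x (inT y) (inT x).
rewrite /= -[_ *: _]/(_ * _) ler_pdivrMl//.
have -> : h *: (y - x) + x = h *: y + (1 - h) *: x.
  by rewrite scalerBr scalerBl scale1r -addrA [_ + x]addrC.
lra.
Unshelve. all: by end_near. Qed.

(** First-order optimality with the smooth part linearized.  Comparing [p] with
    [p + t (z - p)] and using the convexity of [g], the quadratic error of the
    linearization is of order [t ^+ 2] while every other term is of order [t];
    it disappears after division by [t] as [t] tends to 0. *)
Lemma argmin_subdiff (phi : 'rV[R]_n -> R) (g : 'rV[R]_n -> \bar R)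
    (C : R) v p :
  econvex g -> eproper g -> argmin (objective phi g) p ->
  (forall z, phi z <= phi p + dotp v (z - p) + C * norm2 (z - p) ^+ 2) ->
  g p \is a fin_num /\ subdiff g p (- v).
Proof.
move=> gc [gNy [q gq]] pmin phile.
have gpfin : g p \is a fin_num.
  rewrite fin_numElt gNy/= ltey; apply/eqP => gp.
  have := pmin q; rewrite /objective gp addey// leye_eq.
  by move: gq (gNy q); case: (g q).
split=> // z; have := gNy z.
case gzE: (g z) => [b| |]//= _; last by rewrite leey.
have [a gpE] : exists a, g p = a%:E by exists (fine (g p)); rewrite fineK.
rewrite gpE -EFinD lee_fin dotpNl lerBlDr.
apply: (@le_of_le_scale _ _ _ (C * norm2 (z - p) ^+ 2)) => t /andP[t0 t1].
have := gc z p t; rewrite t1 (ltW t0) gzE gpE => /(_ isT).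
set w := t *: z + (1 - t) *: p => gw.
have wp : w - p = t *: (z - p).
  by rewrite /w scalerBl scale1r scalerBr addrCA addrAC subrr add0r.
have := phile w; rewrite wp dotpZr (norm2Z _ _ (ltW t0)) => phiw.
have := pmin w; rewrite /objective gpE.
move: (gNy w) gw; case: (g w) => [c| |]//= _.
rewrite -!EFinM -!EFinD !lee_fin => gw mw.
rewrite -(ler_pM2l t0); rewrite exprMn in phiw.
nra.
Qed.

(** * The proximal gradient operator *)

(** The subgradient [s] at [p] bounds [g] from below by an affine function.
    Where the sum is at most its value at [p], this forces
    [c |z - p|^2 <= <u, z - p>] with [u = 2 c (x - p) - s], hence
    [|z - p| <= |u| / c]: the search is confined to a compact box. *)
Lemma argmin_quad_neq0 (c : R) (g : 'rV[R]_n -> \bar R) x p s :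
  0 < c -> lower_semicontinuous g -> g p \is a fin_num -> subdiff g p s ->
  argmin (objective (fun w => c * norm2 (w - x) ^+ 2) g) !=set0.
Proof.
move=> c0 gl gpfin sp; set h := objective _ g.
have hl : lower_semicontinuous h.
  apply: lsc_objective gl => w.
  apply: (@cvgM R _ (nbhs w)); first exact: cvg_cst.
  exact: continuous_norm2_sqr.
pose u := (c * 2) *: (x - p) - s.
pose M := norm2 u / c.
pose K :=
  [set w : 'rV[R]_n | forall i, `[p 0 i - M, p 0 i + M]%classic (w ord0 i)].
have M0 : 0 <= M by rewrite divr_ge0 ?norm2_ge0// ltW.
have Kc : compact K.
  apply: (@rV_compact R n (fun i => `[p 0 i - M, p 0 i + M]%classic)) => i.
  exact: segment_compact.
have Kp : K p.
  by move=> i; rewrite /= in_itv/= lerBlDr !lerDl M0.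
have [q Kq qmin] := lsc_attains_min _ _ _ _ hl Kc (ex_intro _ _ Kp).
exists q => z /=.
have [/qmin//|Kz] := pselect (K z).
apply: le_trans (qmin _ Kp) _; rewrite /h /objective.
apply: le_trans (leeD2l _ (sp z)).
rewrite -(fineK gpfin) -!EFinD lee_fin.
rewrite leNgt; apply/negP => lt; apply: Kz => i.
have zpM : norm2 (z - p) <= M.
  rewrite /M ler_pdivlMr//.
  have zp : c * norm2 (z - p) ^+ 2 <= norm2 u * norm2 (z - p).
    apply: le_trans (cauchy_schwarz _ _).
    have zxE : z - x = (z - p) - (x - p) by rewrite opprB addrA subrK.
    move: lt; rewrite zxE -(opprB x p) !norm2_sqr /u !dotpE.
    rewrite (dotpC z p) (dotpC z x) (dotpC p x); nra.
  have := norm2_ge0 (z - p); rewrite le_eqVlt => /orP[/eqP <-|e0].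
    by rewrite mul0r norm2_ge0.
  by rewrite -(ler_pM2r e0); nra.
have := le_trans (coord_le_norm2 (z - p) i) zpM.
rewrite !mxE ler_norml => /andP[? ?]; rewrite /= in_itv/=.
by apply/andP; split; lra.
Qed.

(** Dividing by [gamma] moves the scaling from [g] to the quadratic, so that the
    hypotheses on [g] apply without being transferred to [gamma * g]. *)
Lemma argmin_proxE (gamma : R) (g : 'rV[R]_n -> \bar R) x :
  0 < gamma ->
  argmin (fun w => gamma%:E * g w + (2^-1 * norm2 (w - x) ^+ 2)%:E)%E =
  argmin (objective (fun w => (2 * gamma)^-1 * norm2 (w - x) ^+ 2) g).
Proof.
move=> gamma0; set q := fun w => (2 * gamma)^-1 * norm2 (w - x) ^+ 2.
have E w : (gamma%:E * g w + (2^-1 * norm2 (w - x) ^+ 2)%:E =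
            gamma%:E * objective q g w)%E.
  rewrite /objective muleDr// addeC; congr (_ + _)%E.
  by rewrite -EFinM /q; congr _%:E; field; rewrite gt_eqF.
by apply/seteqP; split=> p pmin z; have := pmin z; rewrite !E lee_pmul2l.
Qed.

(** The minimizer of [f + g] provides, through [argmin_subdiff], the affine
    minorant of [g] that makes the proximal problem solvable for every
    [gamma > 0]; without a minimizer [prox] would return the junk value 0. *)
Lemma prox_grad_subgradient (f : 'rV[R]_n -> R) (g : 'rV[R]_n -> \bar R)
    (L gamma : R) x :
  (forall z, differentiable f z) -> lipschitz_grad L f ->
  econvex g -> eproper g -> lower_semicontinuous g ->
  argmin (objective f g) !=set0 -> 0 < gamma ->
  let p := prox_grad gamma f g x in
  subdiff g p (gamma^-1 *: (x - p) - grad f x).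
Proof.
move=> fd fl gc gp gl [xs xsmin] gamma0 p.
have [gxs subxs] : g xs \is a fin_num /\ subdiff g xs (- grad f xs).
  by apply: (argmin_subdiff f g (L / 2)) => // z; exact: descent.
set x' := x - gamma *: grad f x.
pose q w := (2 * gamma)^-1 * norm2 (w - x') ^+ 2.
have c0 : 0 < (2 * gamma)^-1 by rewrite invr_gt0 mulr_gt0.
have pmin : argmin (objective q g) p.
  have [p' p'min] := argmin_quad_neq0 _ _ x' _ _ c0 gl gxs subxs.
  rewrite /p /prox_grad /prox argmin_proxE//.
  by case: xgetP => [? ->//|/(_ p')]; apply: contra_notP.
(* The gradient at [p] of the quadratic [q] is [(p - x') / gamma]. *)
have -> : gamma^-1 *: (x - p) - grad f x = - (gamma^-1 *: (p - x')).
  rewrite -[RHS]scalerN opprB /x' [in RHS]addrAC [RHS]scalerBr scalerA mulVf.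
    by rewrite scale1r.
  by rewrite gt_eqF.
apply: (argmin_subdiff q g (2 * gamma)^-1 _ _ gc gp pmin _).2 => z.
have -> : q z = (2 * gamma)^-1 * norm2 ((z - p) + (p - x')) ^+ 2.
  by rewrite addrA subrK.
rewrite /q !norm2_sqr dotpDl !(dotpDr _ (z - p)) dotpZl.
rewrite (dotpC (z - p) (p - x')).
rewrite le_eqVlt; apply/orP; left; apply/eqP; field.
by rewrite gt_eqF.
Qed.

(** Sum of the subgradient inequality of [g] at [p], the gradient inequality of
    [f] between [x] and [z], and the descent lemma between [x] and [p]. *)
Lemma prox_grad_step (f : 'rV[R]_n -> R) (g : 'rV[R]_n -> \bar R)
    (L gamma : R) x p z :
  convex_function (setT : set (convex_lmodType 'rV[R]_n)) f ->
  (forall z, differentiable f z) -> lipschitz_grad L f ->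
  subdiff g p (gamma^-1 *: (x - p) - grad f x) ->
  (objective f g p + (gamma^-1 * dotp (x - p) (z - p) -
     L / 2 * norm2 (p - x) ^+ 2)%:E <= objective f g z)%E.
Proof.
move=> fc fd fl subp; rewrite /objective addeAC -EFinD.
apply: le_trans (leeD2l _ (subp z)).
rewrite (addeC (g p)) addeA -EFinD leeD2r// lee_fin.
have := descent f L x p fd fl; have := gradient_ineq f x z fc (fd x).
have -> : z - x = (z - p) + (p - x) by rewrite addrA subrK.
by rewrite dotpDr (dotpDl (gamma^-1 *: _)) dotpNl dotpZl; lra.
Qed.

Lemma prox_grad_subdiff (f : 'rV[R]_n -> R) (g : 'rV[R]_n -> \bar R)
    (gamma : R) x p :
  convex_function (setT : set (convex_lmodType 'rV[R]_n)) f ->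
  differentiable f p ->
  subdiff g p (gamma^-1 *: (x - p) - grad f x) ->
  subdiff (objective f g) p
    (gamma^-1 *: (x - p) + (grad f p - grad f x)).
Proof.
move=> fc fd subp z; rewrite /objective.
apply: le_trans (leeD2l _ (subp z)).
rewrite addeAC (addeC (g p)) addeA -!EFinD leeD2r// lee_fin.
have := gradient_ineq f p z fc fd.
rewrite dotpDl (dotpDl (gamma^-1 *: _)) (dotpDl (grad f p)) dotpNl; lra.
Qed.

Lemma norm2_prox_grad_subgrad (f : 'rV[R]_n -> R) (L gamma : R) x p :
  lipschitz_grad L f -> 0 < gamma ->
  norm2 (gamma^-1 *: (x - p) + (grad f p - grad f x)) <=
    (1 + gamma * L) / gamma * norm2 (p - x).
Proof.
move=> fl gamma0.
apply: le_trans (norm2D _ _) _; have := fl p x.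
have gammaV0 : 0 <= gamma^-1 by rewrite invr_ge0 ltW.
rewrite norm2Z// -(norm2N (x - p)) opprB => flp.
have -> : (1 + gamma * L) / gamma = gamma^-1 + L by field; rewrite gt_eqF.
lra.
Qed.

(** * Two steps with inertia *)

(** The right-hand side collects the two steps, with [d] and [e] their
    displacements and [- d - a *: e] the vector from the second output to the
    first.  It exceeds the left-hand side by [a / (2 gamma) * |d + e|^2]: this
    is where half of the inertia [a] is charged to each displacement. *)
Lemma inertia_gain (a L gamma : R) d e : 0 <= a -> 0 < gamma ->
  (2 - a - gamma * L) / (2 * gamma) * (norm2 d ^+ 2 + norm2 e ^+ 2) <=
  (gamma^-1 * dotp (- e) (- e) - L / 2 * norm2 e ^+ 2) +
  (gamma^-1 * dotp (- d) (- d - a *: e) - L / 2 * norm2 d ^+ 2).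
Proof.
move=> a0 gamma0.
have : 0 <= a / (2 * gamma) * dotp (d + e) (d + e).
  by rewrite mulr_ge0 ?dotp_ge0// divr_ge0// mulr_ge0// ltW.
move=> gain; rewrite -subr_ge0; apply: le_trans gain _.
rewrite le_eqVlt; apply/orP; left.
by apply/eqP; rewrite !norm2_sqr !dotpE (dotpC e d); field; rewrite gt_eqF.
Qed.

Lemma dist0_sqr_le (S : set 'rV[R]_n) s :
  S s -> (dist0 S ^+ 2 <= (norm2 s ^+ 2)%:E)%E.
Proof.
move=> Ss.
have d0 : (0 <= dist0 S)%E.
  by apply: le_ereal_inf_tmp => _ [v _ <-]; rewrite lee_fin norm2_ge0.
have ds : (dist0 S <= (norm2 s)%:E)%E by apply: ereal_inf_lbound; exists s.
by rewrite EFin_expe !expe2 lee_pmul.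
Qed.

End ProximalGradientStep.

Theorem theorem3p2 (R : realType) (n : nat)
  (f : 'rV[R]_n -> R) (g : 'rV[R]_n -> \bar R) (L gamma : R)
  (alpha : nat -> R) (x y : nat -> 'rV[R]_n)
  (F := objective f g)
  (f_convex : convex_function (setT : set (convex_lmodType 'rV[R]_n)) f)
  (f_diff : forall z, differentiable f z)
  (L_gt0 : 0 < L)
  (f_lip : lipschitz_grad L f)
  (g_convex : econvex g)
  (g_proper : eproper g)
  (g_lsc : lower_semicontinuous g)
  (argmin_neq0 : argmin F !=set0)
  (argmin_closed : closed (argmin F))
  (Fstar_gtNy : forall xstar, argmin F xstar -> (-oo < F xstar)%E)
  (gamma_gt0 : 0 < gamma)
  (alpha_ge0 : forall k, 0 <= alpha k)
  (xy_iter : alternated_inertia (prox_grad gamma f g) alpha x y)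
  (k : nat) (k_gt0 : (0 < k)%N) (k_even : ~~ odd k) :
  (F (y k.+2) <= F (y k) -
     ((2 - alpha k - gamma * L) / (2 * gamma) *
      (norm2 (y k.+2 - x k.+1)%R ^+ 2 + norm2 (y k.+1 - x k)%R ^+ 2))%:E)%E
  /\
  (0 <= 2 - alpha k - gamma * L ->
   (F (y k) -
     ((2 - alpha k - gamma * L) / (2 * gamma) *
      (norm2 (y k.+2 - x k.+1)%R ^+ 2 + norm2 (y k.+1 - x k)%R ^+ 2))%:E
    <= F (y k) -
     ((2 - alpha k - gamma * L) * gamma / (2 * (1 + gamma * L) ^+ 2))%:E *
       dist0 (subdiff F (y k.+2)) ^+ 2)%E).
Proof.
have step := prox_grad_subgradient f g L gamma _ f_diff f_lip g_convex
  g_proper g_lsc argmin_neq0 gamma_gt0.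
have [ye1 xe1 ye2 _] := xy_iter k k_even.
have [m km m_even] : exists2 m, k = m.+2 & ~~ odd m.
  case: k k_gt0 k_even {ye1 xe1 ye2} => [|[|m]]// _ mo; exists m => //.
  by move: mo; rewrite /= negbK.
(* The previous even iteration ends with [x m.+2 = y m.+2]. *)
have xyk : x k = y k by have [_ _ _] := xy_iter m m_even; rewrite km.
have sub1 := step (x k); rewrite -ye1 in sub1.
have sub2 := step (x k.+1); rewrite -ye2 in sub2.
set N := norm2 (y k.+2 - x k.+1)%R ^+ 2 + norm2 (y k.+1 - x k)%R ^+ 2.
have ineq1 := prox_grad_step f g L gamma _ _ (y k) f_convex f_diff f_lip sub1.
have ineq2 :=
  prox_grad_step f g L gamma _ _ (y k.+1) f_convex f_diff f_lip sub2.
rewrite -/F in ineq1 ineq2.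
set r1 := (X in (F (y k.+1) + X%:E <= _)%E) in ineq1.
set r2 := (X in (F (y k.+2) + X%:E <= _)%E) in ineq2.
split.
  rewrite leeBrDr//.
  have : (2 - alpha k - gamma * L) / (2 * gamma) * N <= r1 + r2.
    rewrite /N /r1 /r2 xe1 -xyk.
    set e := y k.+1 - x k; set d := y k.+2 - (y k.+1 + alpha k *: e).
    have -> : y k.+1 + alpha k *: e - y k.+2 = - d by rewrite opprB.
    have -> : y k.+1 - y k.+2 = - d - alpha k *: e.
      by rewrite /d opprB addrAC addrK.
    have -> : x k - y k.+1 = - e by rewrite opprB.
    exact: inertia_gain.
  rewrite -lee_fin => /(leeD2l (F (y k.+2))) /le_trans; apply.
  by rewrite (addrC r1) EFinD addeA; apply: le_trans ineq1; rewrite leeD2r.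
move=> coef0; apply: leeB => //.
have gL0 : 0 < 1 + gamma * L by rewrite addr_gt0// mulr_gt0.
apply: (@le_trans _ _
  (((2 - alpha k - gamma * L) * gamma / (2 * (1 + gamma * L) ^+ 2))%:E *
   (norm2 (gamma^-1 *: (x k.+1 - y k.+2) +
     (grad f (y k.+2) - grad f (x k.+1))) ^+ 2)%:E)%E).
  apply: lee_wpmul2l; last first.
    exact/dist0_sqr_le/prox_grad_subdiff.
  by rewrite lee_fin divr_ge0// mulr_ge0 ?exprn_ge0// ltW.
have := norm2_prox_grad_subgrad f L gamma (x k.+1) (y k.+2) f_lip gamma_gt0.
set s := norm2 (_ *: _ + _); set d := norm2 (y k.+2 - _) => sd.
rewrite -EFinM lee_fin; apply: (@le_trans _ _
  ((2 - alpha k - gamma * L) / (2 * gamma) * d ^+ 2)); last first.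
  by rewrite ler_wpM2l ?divr_ge0 ?lerDl ?sqr_ge0// mulr_ge0 ?ltW.
have s2 : s ^+ 2 <= ((1 + gamma * L) / gamma * d) ^+ 2.
  by rewrite lerXn2r// nnegrE ?norm2_ge0// mulr_ge0 ?norm2_ge0// divr_ge0// ltW.
apply: le_trans (ler_wpM2l _ s2) _.
  by rewrite divr_ge0 ?mulr_ge0 ?exprn_ge0// ltW.
by rewrite le_eqVlt; apply/orP; left; apply/eqP; field; rewrite !gt_eqF.
Qed.
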